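(* Let $Y$ be a real-valued random variable with mean $\mu_Y=E(Y)$, let $X$ be a random vector in $\mathbb{R}^p$, and let $m_{\theta^*}(X)$ be a real-valued prediction function of $Y$ based on $X$, with $E(Y^2)<\infty$, $E\{m_{\theta^*}(X)^2\}<\infty$ and $\mathrm{var}(m_{\theta^*}(X))>0$. Let $$m^{(c)}_{\theta^*}(X)=\mu_Y+\frac{\mathrm{cov}(Y,m_{\theta^*}(X))}{\mathrm{var}(m_{\theta^*}(X))}\,\bigl[m_{\theta^*}(X)-E\{m_{\theta^*}(X)\}\bigr]$$ be the linearly corrected prediction function of $m_{\theta^*}(X)$. Then: (a) (Variance decomposition) $$\mathrm{var}(Y)=E\{m^{(c)}_{\theta^*}(X)-\mu_Y\}^2+E\{Y-m^{(c)}_{\theta^*}(X)\}^2.$$ (b) (Prediction error decomposition) $$MSPE(m_{\theta^*}(X))=E\{Y-m^{(c)}_{\theta^*}(X)\}^2+E\{m^{(c)}_{\theta^*}(X)-m_{\theta^*}(X)\}^2.$$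
   Context: For a (measurable) function $P:\mathbb{R}^p\to\mathbb{R}$, the mean squared prediction error of $P(X)$ for predicting $Y$ is $MSPE(P(X))=E\{Y-P(X)\}^2$. The function $m_{\theta^*}$ is a prediction function arising from a member $F_{\theta^*}(y|x)$ of a family of conditional distribution functions $\{F_\theta(y|x):\theta\in\Theta\}$ modelling $Y$ given $X$ (for example the conditional mean or conditional median under $F_{\theta^*}(\cdot|x)$). The model may be misspecified, i.e. the true conditional distribution of $Y$ given $X$ need not belong to the family, so $m_{\theta^*}$ is an arbitrary function of $X$ for the purposes of this statement. Throughout, $E\{\cdot\}^2$ means the expectation of the square. *)

(* Defs.v *)
From HB Require Import structures.
From mathcomp Require Import all_boot all_order all_algebra.
From mathcomp Require Import all_classical all_reals all_analysis.

Set Implicit Arguments.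
Unset Strict Implicit.
Unset Printing Implicit Defensive.
Import Order.TTheory GRing.Theory Num.Theory.
Local Open Scope ring_scope.

(* R^p is [p.-tuple R] with the sigma-algebra generated by the coordinates,
   i.e. the Borel sigma-algebra of R^p. *)

Definition mspe d (T : measurableType d) (R : realType) (P : probability T R)
    (p : nat) (X : {RV P >-> p.-tuple R}) (Y : {RV P >-> R})
    (f : p.-tuple R -> R) : \bar R :=
  'E_P[fun w => (Y w - f (X w)) ^+ 2].

(* [fine] only turns moments that are finite when Y and m(X) are square
   integrable into reals; the division is meaningful when 'V_P[m(X)] > 0. *)
Definition linear_correction d (T : measurableType d) (R : realType)
    (P : probability T R) (p : nat) (X : {RV P >-> p.-tuple R})
    (Y : {RV P >-> R}) (m : p.-tuple R -> R) : p.-tuple R -> R :=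
  fun x => fine 'E_P[Y]
         + fine (covariance P Y (m \o X)) / fine 'V_P[m \o X]
           * (m x - fine 'E_P[m \o X]).

(* Main.v *)
Require Import Defs.
From HB Require Import structures.
From mathcomp Require Import all_boot all_order all_algebra.
From mathcomp Require Import all_classical all_reals all_analysis.
From mathcomp Require Import ring.

(** The corrected predictor mc(X) is the best affine predictor of Y from
    M = m(X): its slope cov(Y, M) / var(M) is chosen so that the residual
    Y - mc(X) is uncorrelated with M, and its intercept so that this residual
    has mean zero. Hence, in L2, the residual is orthogonal to every function
    a + b M ([expectation_mul_affine_eq0]). Both decompositions are then
    Pythagoras' identity ([expectation_sqr_pythagoras]) for the residual and
    a function of this form: mc(X) - E[Y] in
      Y - E[Y] = (mc(X) - E[Y]) + (Y - mc(X)),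
    and mc(X) - M in
      Y - M = (Y - mc(X)) + (mc(X) - M). *)

Set Implicit Arguments.
Unset Strict Implicit.
Unset Printing Implicit Defensive.
Import Order.TTheory GRing.Theory Num.Theory.
Local Open Scope ring_scope.
Local Open Scope ereal_scope.

Section square_integrable.
Context d (T : measurableType d) (R : realType) (P : probability T R).
Implicit Types (f U V W M Y : T -> R) (a b : R).

Lemma Lfun2_expectation_sqr f : measurable_fun [set: T] f ->
  'E_P[fun w => (f w ^+ 2)%R] < +oo -> f \in Lfun P 2%:E.
Proof.
move=> mf f2; rewrite inE/=; apply/andP; split; rewrite inE//=.
rewrite /finite_norm unlock poweR_lty//.
under eq_integral => w _ do rewrite /= powR_mulrn// -normrX ger0_norm ?sqr_ge0//.
by move: f2; rewrite unlock.
Qed.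

Lemma Lfun2_affine M a b : M \in Lfun P 2%:E ->
  (fun w => a + b * M w)%R \in Lfun P 2%:E.
Proof.
move=> M2; rewrite (_ : (fun w => _) = cst a \+ b \o* M)%R.
  rewrite rpredD ?lee1n//= => _; first exact: Lfun_cst.
  by rewrite Lfun_scale ?ler1n.
by apply/funext => w /=; rewrite mulrC.
Qed.

(** Being centered and uncorrelated with M amounts to orthogonality to 1 and
    to M, hence to their span. *)
Lemma expectation_mul_affine_eq0 W M a b :
    W \in Lfun P 2%:E -> M \in Lfun P 2%:E ->
    'E_P[W] = 0 -> covariance P W M = 0 ->
  'E_P[fun w => (W w * (a + b * M w))%R] = 0.
Proof.
move=> W2 M2 EW0 covWM.
have Pfin : P setT \is a fin_num := fin_num_measure P _ measurableT.
have W1 := Lfun_subset12 Pfin W2.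
have M1 := Lfun_subset12 Pfin M2.
have WM1 : (W * M)%R \in Lfun P 1 := Lfun2_mul_Lfun1 W2 M2.
have EWM0 : 'E_P[W * M] = 0.
  by move: covWM; rewrite covarianceE// EW0 mul0e sube0.
rewrite (_ : (fun w => _) = a \o* W \+ b \o* (W * M))%R; last first.
  by apply/funext => w; rewrite /= fctE; ring.
by rewrite expectationD ?Lfun_scale// !expectationZl// EW0 EWM0 !mule0 adde0.
Qed.

Lemma expectation_sqr_pythagoras U V :
    U \in Lfun P 2%:E -> V \in Lfun P 2%:E ->
    'E_P[fun w => (U w * V w)%R] = 0 ->
  'E_P[fun w => ((U w + V w) ^+ 2)%R] =
  'E_P[fun w => (U w ^+ 2)%R] + 'E_P[fun w => (V w ^+ 2)%R].
Proof.
move=> U2 V2 EUV0.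
have sqr1 f : f \in Lfun P 2%:E -> (fun w => f w ^+ 2)%R \in Lfun P 1.
  by move=> f2; apply/Lfun1_integrable; exact: Lfun2_integrable_sqr.
have UV1 : (fun w => U w * V w)%R \in Lfun P 1 := Lfun2_mul_Lfun1 U2 V2.
rewrite (_ : (fun w => (U w + V w) ^+ 2) = (fun w => U w ^+ 2) \+
    (2 \o* (fun w => U w * V w) \+ (fun w => V w ^+ 2)))%R; last first.
  by apply/funext => w /=; ring.
rewrite !expectationD ?sqr1 ?rpredD ?Lfun_scale ?sqr1//.
by rewrite expectationZl// EUV0 mule0 add0e.
Qed.

Definition regression_slope Y M : R :=
  (fine (covariance P Y M) / fine 'V_P[M])%R.

Definition regression_residual Y M : T -> R := fun w =>
  (Y w - (fine 'E_P[Y] + regression_slope Y M * (M w - fine 'E_P[M])))%R.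

Lemma regression_residual_decomp Y M : regression_residual Y M =
  ((Y \- regression_slope Y M \o* M)
   \- cst (fine 'E_P[Y] - regression_slope Y M * fine 'E_P[M]))%R.
Proof. by apply/funext => w; rewrite /regression_residual/=; ring. Qed.

Lemma Lfun2_regression_residual Y M :
    Y \in Lfun P 2%:E -> M \in Lfun P 2%:E ->
  regression_residual Y M \in Lfun P 2%:E.
Proof.
move=> Y2 M2; rewrite regression_residual_decomp.
rewrite rpredB ?lee1n//= => _; last exact: Lfun_cst.
by rewrite rpredB ?lee1n//= => _; rewrite Lfun_scale ?ler1n.
Qed.

Lemma expectation_regression_residual Y M :
    Y \in Lfun P 2%:E -> M \in Lfun P 2%:E ->
  'E_P[regression_residual Y M] = 0.
Proof.
move=> Y2 M2.
have Pfin : P setT \is a fin_num := fin_num_measure P _ measurableT.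
have Y1 := Lfun_subset12 Pfin Y2.
have M1 := Lfun_subset12 Pfin M2.
rewrite regression_residual_decomp.
rewrite !expectationB ?rpredB ?Lfun_scale ?Lfun_cst//.
rewrite expectationZl// !expectation_cst (EFinM (regression_slope Y M)).
rewrite !fineK ?expectation_fin_num// subee//.
by rewrite fin_numB fin_numM ?expectation_fin_num.
Qed.

(** The slope is the root b of cov(Y, M) - b var(M), the covariance of
    Y - b M with M. *)
Lemma covariance_regression_residual Y M :
    Y \in Lfun P 2%:E -> M \in Lfun P 2%:E -> 0 < 'V_P[M] ->
  covariance P (regression_residual Y M) M = 0.
Proof.
move=> Y2 M2 VM0.
have Pfin : P setT \is a fin_num := fin_num_measure P _ measurableT.
have Y1 := Lfun_subset12 Pfin Y2.
have M1 := Lfun_subset12 Pfin M2.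
have YM1 := Lfun2_mul_Lfun1 Y2 M2.
have MM1 := Lfun2_mul_Lfun1 M2 M2.
have bM2 b : (b \o* M)%R \in Lfun P 2%:E by apply: Lfun_scale; rewrite ?ler1n.
have fcov := covariance_fin_num Y1 M1 YM1.
have fvar := variance_fin_num M2.
rewrite regression_residual_decomp covarianceBl ?Lfun_cst//; last first.
  by rewrite rpredB ?lee1n.
rewrite covariance_cst_l sube0 covarianceBl// covarianceZl//.
rewrite -[covariance P M M]/('V_P[M]) -(fineK fvar) -EFinM divfK.
  by rewrite fineK// subee.
by rewrite gt_eqF// fine_gt0// VM0 ltey_eq fvar.
Qed.

Lemma expectation_regression_residual_mul_affine Y M a b :
    Y \in Lfun P 2%:E -> M \in Lfun P 2%:E -> 0 < 'V_P[M] ->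
  'E_P[fun w => (regression_residual Y M w * (a + b * M w))%R] = 0.
Proof.
move=> Y2 M2 VM0; apply: expectation_mul_affine_eq0 => //.
- exact: Lfun2_regression_residual.
- exact: expectation_regression_residual.
- exact: covariance_regression_residual.
Qed.

(** The common source of both decompositions, applied with V = mc(X) - E[Y]
    and with V = mc(X) - M. That V is affine in M is an equation rather than a
    substituted form so that V can be given as it appears there. *)
Lemma expectation_sqr_affine_decomp Y M V a b :
    Y \in Lfun P 2%:E -> M \in Lfun P 2%:E -> 0 < 'V_P[M] ->
    V = (fun w => a + b * M w)%R ->
  'E_P[fun w => ((regression_residual Y M w + V w) ^+ 2)%R] =
  'E_P[fun w => (regression_residual Y M w ^+ 2)%R]
  + 'E_P[fun w => (V w ^+ 2)%R].
Proof.
move=> Y2 M2 VM0 ->; apply: expectation_sqr_pythagoras.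
- exact: Lfun2_regression_residual.
- exact: Lfun2_affine.
- exact: expectation_regression_residual_mul_affine.
Qed.

End square_integrable.

Theorem lemma2p1 (d : measure_display) (T : measurableType d) (R : realType)
    (P : probability T R) (p : nat)
    (Y : {RV P >-> R}) (X : {RV P >-> p.-tuple R})
    (m : {mfun p.-tuple R >-> R})
    (hY : 'E_P[fun w => (Y w ^+ 2)%R] < +oo)
    (hm : 'E_P[fun w => (m (X w) ^+ 2)%R] < +oo)
    (hvar : 0 < 'V_P[m \o X]) :
  let muY := fine 'E_P[Y] in
  let mc := linear_correction X Y m in
  'V_P[Y] = 'E_P[fun w => ((mc (X w) - muY) ^+ 2)%R]
            + 'E_P[fun w => ((Y w - mc (X w)) ^+ 2)%R]
  /\
  mspe X Y m = 'E_P[fun w => ((Y w - mc (X w)) ^+ 2)%R]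
               + 'E_P[fun w => ((mc (X w) - m (X w)) ^+ 2)%R].
Proof.
move=> muY mc.
have Y2 : (Y : T -> R) \in Lfun P 2%:E by exact: Lfun2_expectation_sqr.
have M2 : m \o X \in Lfun P 2%:E.
  by apply: Lfun2_expectation_sqr => //; exact: measurableT_comp.
pose b := regression_slope P Y (m \o X).
pose muM := fine 'E_P[m \o X].
have resE w : (Y w - mc (X w))%R = regression_residual P Y (m \o X) w by [].
have mcE w : mc (X w) = (muY + b * (m (X w) - muM))%R by [].
split.
- rewrite addeC /variance unlock.
  rewrite -(@expectation_sqr_affine_decomp _ _ _ _ Y (m \o X)
    (fun w => mc (X w) - muY)%R (- (b * muM))%R b)//.
    by congr expectation; apply/funext => w; rewrite -resE subrKA.
  by apply/funext => w; rewrite mcE/=; ring.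
- rewrite -(@expectation_sqr_affine_decomp _ _ _ _ Y (m \o X)
    (fun w => mc (X w) - m (X w))%R (muY - b * muM)%R (b - 1)%R)//.
    by congr expectation; apply/funext => w; rewrite -resE subrKA.
  by apply/funext => w; rewrite mcE/=; ring.
Qed.
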